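(* Let $\mathcal H$ be a real Hilbert space and let $\Phi:\mathcal H\to\mathbb R$ be a convex differentiable function whose gradient $\nabla\Phi$ is Lipschitz continuous on bounded sets, such that the interior of $\operatorname{argmin}\Phi$ (for the norm topology) is nonempty. Let $t_0>0$, $\alpha>3$, and let $g:[t_0,+\infty[\to\mathcal H$ satisfy $\int_{t_0}^{+\infty}t\|g(t)\|\,dt<+\infty$. Let $x:[t_0,+\infty[\to\mathcal H$ be a classical global solution of $$\ddot x(t)+\frac{\alpha}{t}\dot x(t)+\nabla\Phi(x(t))=g(t).$$ Then there exists some $x^*\in\operatorname{argmin}\Phi$ such that $x(t)\to x^*$ strongly (in norm) as $t\to+\infty$.
   Context: $\|\cdot\|$ is the norm of $\mathcal H$ associated with its scalar product. *)

(* Defs.v *)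
From HB Require Import structures.
From mathcomp Require Import all_boot all_order all_algebra.
From mathcomp Require Import all_classical all_reals all_analysis.

Set Implicit Arguments.
Unset Strict Implicit.
Unset Printing Implicit Defensive.

Import Order.TTheory GRing.Theory Num.Theory.
Import numFieldNormedType.Exports.

Local Open Scope classical_set_scope.
Local Open Scope ring_scope.

(* A real Hilbert space is a complete normed module [H] over the reals with a
   positive definite symmetric bilinear form [dot : {dot H for idfun}] inducing
   the norm of [H], hence also its topology. *)
Definition norm_from_dot (R : realType) (H : completeNormedModType R)
    (dot : {dot H for (@idfun R)}) : Prop :=
  forall u : H, `|u| = Num.sqrt (dot u u).

(* [G] is determined by [Phi]: [dot] is definite, and Riesz representation
   provides such a [G] as soon as [Phi] is differentiable. *)
Definition is_gradient (R : realType) (H : completeNormedModType R)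
    (dot : {dot H for (@idfun R)}) (Phi : H -> R) (G : H -> H) : Prop :=
  forall u h : H, 'd Phi u h = dot (G u) h.

Definition argmin (R : realType) (T : Type) (Phi : T -> R) : set T :=
  [set u | forall v, Phi u <= Phi v].

Definition lipschitz_on_bounded_sets (R : realType)
    (V W : normedModType R) (f : V -> W) : Prop :=
  forall B : set V, bounded_set B -> [lipschitz f u | u in B].

(* The difference quotient is restricted to [D], so that at an endpoint of an
   interval [D] the derivative is the one-sided one and values of [f] outside
   of [D] are irrelevant. *)
Definition is_derive_within (R : realType) (V : normedModType R) (D : set R)
    (f : R -> V) (t : R) (l : V) : Prop :=
  (s - t)^-1 *: (f s - f t) @[s --> within D t^'] --> l.

(* "Classical" means of class C^2 up to the initial time [t0]. *)
Definition classical_global_solution (R : realType) (H : normedModType R)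
    (t0 alpha : R) (G : H -> H) (g x : R -> H) : Prop :=
  exists dx ddx : R -> H,
    [/\ forall t, t0 <= t -> is_derive_within `[t0, +oo[ x t (dx t),
        forall t, t0 <= t -> is_derive_within `[t0, +oo[ dx t (ddx t),
        {within `[t0, +oo[, continuous ddx} &
        forall t, t0 <= t ->
          ddx t + (alpha / t) *: dx t + G (x t) = g t].

(* Main.v *)
(* Let z be an interior point of argmin Phi, m = Phi z and c = alpha - 1, and put
   v(t) = c (x(t) - z) + t x'(t), so that v' = t (g - grad Phi(x)). The energy
   E = t^2 (Phi(x) - m) + |v|^2 / 2 satisfies
     E' <= t |g| |v| - (c - 2) t <grad Phi(x), x - z>.
   As E is nonnegative and t |g| is integrable, Gronwall bounds E and v. Since a
   ball of radius rho around z is contained in argmin Phi, convexity yields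
   rho |grad Phi(x)| <= <grad Phi(x), x - z>; hence t |grad Phi(x)| is integrable
   and v, having an integrable derivative, converges in norm. The Euler equation
   c y + t y' = v for y = x - z then forces x - z to converge to lim v / c. The
   limit of x is a minimizer because t^2 (Phi(x) - m) <= E is bounded. *)

Require Import Defs.
From HB Require Import structures.
From mathcomp Require Import all_boot all_order all_algebra.
From mathcomp Require Import all_classical all_reals all_analysis.
From mathcomp Require Import ring lra.

Set Implicit Arguments.
Unset Strict Implicit.
Unset Printing Implicit Defensive.

Import Order.TTheory GRing.Theory Num.Theory.
Import numFieldNormedType.Exports.

Local Open Scope classical_set_scope.
Local Open Scope ring_scope.

(** * Derivatives of curves in a normed space *)

Lemma is_derive1_cvgP (R : numFieldType) (V : normedModType R) (f : R -> V)
    (t : R) (l : V) :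
  is_derive t 1 f l <-> h^-1 *: (f (h + t) - f t) @[h --> 0^'] --> l.
Proof.
have E : (fun h => h^-1 *: ((f \o shift t) (h *: (1 : R)) - f t))
    = (fun h => h^-1 *: (f (h + t) - f t)).
  by apply/funext => h /=; rewrite [h *: 1]mulr1.
split=> [[fd <-]|fl]; first by rewrite -E; exact: fd.
rewrite -E in fl; split; first by apply/cvg_ex; exists l.
exact: (cvg_lim (@norm_hausdorff _ _)).
Qed.

Lemma is_derive_continuous (R : numFieldType) (V : normedModType R) (v : R -> V)
    (t : R) (dv : V) :
  is_derive t 1 v dv -> {for t, continuous v}.
Proof. by case=> /derivable1_diffP vt _; exact: differentiable_continuous. Qed.

Lemma is_derive_cvg_shift (R : realType) (V : normedModType R) (v : R -> V)
    (t : R) (dv : V) :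
  is_derive t 1 v dv -> v (h + t) @[h --> 0^'] --> v t.
Proof.
move=> /is_derive_continuous vt.
apply: (@cvg_comp _ _ _ (fun h => h + t) v _ (nbhs t)) => //.
apply: cvg_trans (_ : h + t @[h --> 0] --> t); first exact/cvg_app/nbhs_dnbhs.
by rewrite -[X in _ --> X]add0r; apply: cvgD; [exact: cvg_id|exact: cvg_cst].
Qed.

Lemma is_derive1_mul (R : realType) (f g : R -> R) (t df dg : R) :
  is_derive t 1 f df -> is_derive t 1 g dg ->
  is_derive t 1 (fun s => f s * g s) (df * g t + f t * dg).
Proof.
move=> fd gd; apply: is_derive_eq (is_deriveM fd gd) _.
by rewrite addrC; congr (_ + _); exact: mulrC.
Qed.

Lemma is_derive1_scale (R : realType) (V : normedModType R) (f : R -> R)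
    (v : R -> V) (t df : R) (dv : V) :
  is_derive t 1 f df -> is_derive t 1 v dv ->
  is_derive t 1 (fun s => f s *: v s) (df *: v t + f t *: dv).
Proof.
move=> fd vd; apply/is_derive1_cvgP.
have vc := is_derive_cvg_shift vd.
(* The increment is split so that [v] is evaluated at the shifted time in one term only; that factor
   converges by continuity of [v]. *)
have -> : (fun h => h^-1 *: (f (h + t) *: v (h + t) - f t *: v t))
   = (fun h => (h^-1 *: (f (h + t) - f t)) *: v (h + t)
             + f t *: (h^-1 *: (v (h + t) - v t))).
  apply/funext => h; rewrite -[h^-1 *: (f (h + t) - f t)]/(h^-1 * (f (h + t) - f t)).
  rewrite -scalerA [f t *: (_ *: _)]scalerA [f t * _]mulrC -scalerA -scalerDr.
  by congr (_ *: _); rewrite scalerBl scalerBr addrA subrK.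
apply: cvgD; apply: cvgZ => //; try exact: cvg_cst; exact/is_derive1_cvgP.
Qed.

(** * Scalar product: Cauchy-Schwarz, continuity, product rule *)

Section InnerProduct.
Context (R : realType) (H : completeNormedModType R).
Context (dot : {dot H for (@idfun R)}) (normE : norm_from_dot dot).

Lemma dotC (u v : H) : dot u v = dot v u.
Proof. by have := hermC dot u v; rewrite expr0 mul1r. Qed.

Lemma dotDl (u v w : H) : dot (u + v) w = dot u w + dot v w.
Proof. exact: linearDl. Qed.

Lemma dotBl (u v w : H) : dot (u - v) w = dot u w - dot v w.
Proof. exact: linearBl. Qed.

Lemma dotZl (k : R) (u v : H) : dot (k *: u) v = k * dot u v.
Proof. exact: linearZl_LR. Qed.

Lemma dotDr (u v w : H) : dot w (u + v) = dot w u + dot w v.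
Proof. exact: linearDr. Qed.

Lemma dotBr (u v w : H) : dot w (u - v) = dot w u - dot w v.
Proof. exact: linearBr. Qed.

Lemma dotZr (k : R) (u v : H) : dot u (k *: v) = k * dot u v.
Proof. exact: linearZr_LR. Qed.

Lemma dotuu (u : H) : dot u u = `|u| ^+ 2.
Proof.
rewrite normE sqr_sqrtr//; have [->|u0] := eqVneq u 0; first by rewrite linear0r.
exact/ltW/neq0_dnorm_gt0.
Qed.

Lemma dot_polarization (u v : H) :
  dot u v = (`|u + v| ^+ 2 - `|u - v| ^+ 2) / 4.
Proof.
by rewrite -!dotuu dotBl !dotBr dotDl !dotDr (dotC v u); field.
Qed.

(** Cauchy-Schwarz: the squared norm of |v| u - |u| v expands to 2 |u| |v| (|u| |v| - <u, v>), and
    it is nonnegative. *)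
Lemma dot_le (u v : H) : dot u v <= `|u| * `|v|.
Proof.
have [->|u0] := eqVneq u 0; first by rewrite linear0l normr0 mul0r.
have [->|v0] := eqVneq v 0; first by rewrite linear0r normr0 mulr0.
have uv0 : 0 < `|u| * `|v| by rewrite mulr_gt0 ?normr_gt0.
have := sqr_ge0 `| `|v| *: u - `|u| *: v |; rewrite -dotuu.
rewrite !(dotBl, dotBr) !(dotZl, dotZr) (dotC v u) !dotuu => ge0.
rewrite -(ler_pM2l uv0) -subr_ge0 -(pmulr_rge0 _ (ltr0n R 2)).
by apply: le_trans ge0 _; rewrite le_eqVlt; apply/orP; left; apply/eqP; ring.
Qed.

(** By polarization, joint continuity of [dot] reduces to continuity of the norm. *)
Lemma cvg_dot (T : Type) (F : set_system T) (FF : Filter F) (f g : T -> H)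
    (a b : H) :
  f x @[x --> F] --> a -> g x @[x --> F] --> b ->
  dot (f x) (g x) @[x --> F] --> dot a b.
Proof.
move=> fa gb; rewrite dot_polarization.
under eq_fun do rewrite dot_polarization.
apply: cvgM; last exact: cvg_cst.
by apply: cvgB; rewrite expr2; apply: cvgM; apply: cvg_norm;
  (exact: cvgD || exact: cvgB).
Qed.

Lemma is_derive_dot (f g : R -> H) (t : R) (df dg : H) :
  is_derive t 1 f df -> is_derive t 1 g dg ->
  is_derive t 1 (fun s => dot (f s) (g s)) (dot df (g t) + dot (f t) dg).
Proof.
move=> fd gd; apply/is_derive1_cvgP.
have gc := is_derive_cvg_shift gd.
have -> : (fun h => h^-1 *: (dot (f (h + t)) (g (h + t)) - dot (f t) (g t)))
   = (fun h => dot (h^-1 *: (f (h + t) - f t)) (g (h + t))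
             + dot (f t) (h^-1 *: (g (h + t) - g t))).
  apply/funext => h; rewrite dotZl dotZr dotBl dotBr.
  by rewrite -mulrDr addrA subrK.
apply: cvgD; apply: cvg_dot => //; try exact: cvg_cst; exact/is_derive1_cvgP.
Qed.

End InnerProduct.

(** * Monotonicity and bounded primitives on a half-line *)

Lemma is_derive_le0_nincry (R : realType) (f df : R -> R) (a : R) :
  (forall t, a < t -> is_derive t 1 f (df t)) ->
  (forall t, a < t -> df t <= 0) ->
  forall s t, a < s -> s <= t -> f t <= f s.
Proof.
move=> fd df0 s t ac st.
have fder u : s <= u -> is_derive u 1 f (df u).
  by move=> su; apply: fd; exact: lt_le_trans su.
apply: (@ler0_derive1_nincry _ f s) => //.
- by move=> u; rewrite in_itv/= andbT => /ltW/fder [].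
- move=> u; rewrite in_itv/= andbT => su; rewrite derive1E.
  have [_ ->] := fder _ (ltW su); apply: df0; exact: lt_trans su.
- apply: derivable_within_continuous => u; rewrite in_itv/= andbT.
  by move=> /fder [].
Qed.

(** The primitive starts at [b], strictly after [a], because [f] is known to be continuous only
    beyond [a]. Its bound is the full integral; for [t < b] the interval is empty and the primitive
    is 0, so the bounds hold for every [t]. *)
Lemma bounded_primitive (R : realType) (f : R -> R) (a b : R) :
  a < b -> (forall t, a < t -> {for t, continuous f}) ->
  (forall t, a <= t -> 0 <= f t) ->
  (\int[lebesgue_measure]_(t in `[a, +oo[) (f t)%:E < +oo)%E ->
  exists F C, (forall t, b < t -> is_derive t 1 F (f t)) /\
    (forall t, 0 <= F t <= C).
Proof.
move=> ab fc f0 fint.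
have mf : measurable_fun `[a, +oo[ f.
  (* Adding the endpoint [a] does not affect measurability. *)
  apply/measurable_realfun.measurable_fun_itv_obnd_cbndP.
  apply: measurable_realfun.open_continuous_measurable_fun => //.
  by move=> t; rewrite inE/= in_itv/= andbT => /fc.
have f0' t : `[a, +oo[%classic t -> (0 <= (f t)%:E)%E.
  by rewrite /= in_itv/= andbT lee_fin => /f0.
have sub t : `[b, t] `<=` `[a, +oo[%classic.
  by move=> u; rewrite /= !in_itv/= andbT => /andP[/(le_trans (ltW ab))].
have le t : (\int[lebesgue_measure]_(u in `[b, t]) (f u)%:E
    <= \int[lebesgue_measure]_(u in `[a, +oo[) (f u)%:E)%E.
  by apply: ge0_subset_integral => //; exact/measurable_realfun.measurable_EFinP.
have ge0 t : (0 <= \int[lebesgue_measure]_(u in `[b, t]) (f u)%:E)%E.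
  by apply: integral_ge0 => u /sub/f0'.
exists (fun t => \int[lebesgue_measure]_(u in `[b, t]) f u),
  (fine (\int[lebesgue_measure]_(u in `[a, +oo[) (f u)%:E)); split.
(* The fundamental theorem is applied on [[b, t + 1]], so that [t] is an interior point. *)
- move=> t bt; have [| |||tD te] := @continuous_FTC1_closed _ f b t (t + 1).
  + by rewrite ltrDl.
  + apply: continuous_compact_integrable; first exact: segment_compact.
    apply: continuous_in_subspaceT => u; rewrite inE/= in_itv/= => /andP[bu _].
    by apply: fc; exact: lt_le_trans bu.
  + by [].
  + by apply: fc; exact: lt_trans bt.
  + by split=> //; rewrite -derive1E.
- move=> t; rewrite fine_ge0 ?ge0//= fine_le ?ge0_fin_numE ?ge0//.
  + exact: le_lt_trans fint.
  + exact: le_trans (le t).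
Qed.

(** * Gradient inequalities for a convex function *)

Section Convex.
Context (R : realType) (H : completeNormedModType R).
Context (dot : {dot H for (@idfun R)}) (normE : norm_from_dot dot).
Context (Phi : H -> R) (G : H -> H).
Context (Phi_convex : convex_function [set: convex_lmodType H] Phi)
        (Phi_diff : forall u : H, differentiable Phi u)
        (GE : is_gradient dot Phi G).

(** For 0 < h <= 1, convexity bounds the difference quotient of [Phi] at [u] along [v - u] by
    [Phi v - Phi u]; then h tends to 0 from the right. *)
Lemma gradient_inequality (u v : H) : Phi u + dot (G u) (v - u) <= Phi v.
Proof.
rewrite -GE -deriveE//; set w := v - u.
have dPhi : derivable Phi u w by exact: diff_derivable.
have lim : h^-1 *: ((Phi \o shift u) (h *: w) - Phi u) @[h --> 0^'+] --> 'D_w Phi u.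
  exact: cvg_dnbhs_at_right dPhi.
rewrite addrC -lerBrDr -(cvg_lim (@Rhausdorff R) lim); apply: limr_le.
- by apply/cvg_ex; exists ('D_w Phi u).
- near=> h.
  have h0 : 0 < h by near: h; exact: nbhs_right_gt.
  have h1 : h <= 1 by near: h; exact: nbhs_right_le.
  have := @Phi_convex (Itv01 (ltW h0) h1) v u (in_setT _) (in_setT _).
  rewrite convRE /unstable.onem /= => le.
  have -> : h *: w + u = h *: v + (1 - h) *: u.
    by rewrite /w scalerBr scalerBl scale1r -addrA [- _ + u]addrC.
  rewrite [_ *: _]mulrC ler_pdivrMr// lerBlDr.
  apply: le_trans le _; rewrite le_eqVlt; apply/orP; left; apply/eqP; ring.
Unshelve. all: end_near.
Qed.

(** The gradient inequality is tested at the point [p] of the ball farthest from [z] in the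
    direction [G u]. As [p] is a minimizer, <G u, p - u> <= 0, and this product equals rho |G u| -
    <G u, u - z>. *)
Lemma gradient_interior (z : H) (rho : R) :
  0 < rho -> (forall p, `|p - z| <= rho -> argmin Phi p) ->
  forall u, rho * `|G u| <= dot (G u) (u - z).
Proof.
move=> rho0 zint u.
have [->|Gu0] := eqVneq (G u) 0.
  rewrite normr0 mulr0 le_eqVlt; apply/orP; left.
  by rewrite -(scale0r (0 : H)) dotZl mul0r.
have nGu : 0 < `|G u| by rewrite normr_gt0.
pose p := z + (rho / `|G u|) *: G u.
have /zint/(_ u) : `|p - z| <= rho.
  rewrite /p addrAC subrr add0r normrZ ger0_norm; last by rewrite divr_ge0// ltW.
  by rewrite divfK// normr_eq0.
have := gradient_inequality u p; set d := dot (G u) (u - z).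
have -> : p - u = (rho / `|G u|) *: G u - (u - z).
  by rewrite /p opprB [z + _]addrC addrA.
rewrite dotBr -/d dotZr (dotuu normE) expr2 mulrA divfK ?gt_eqF// => A B.
by rewrite -subr_le0 -(lerD2l (Phi u)) addr0; apply: le_trans B.
Qed.

End Convex.

(** * Curves whose speed is dominated by a real derivative *)

Section Curves.
Context (R : realType) (H : completeNormedModType R).
Context (dot : {dot H for (@idfun R)}) (normE : norm_from_dot dot).

(* Mean value inequality: pair [v t - v s] with the curve. *)
Lemma dist_le_primitive (v dv : R -> H) (F dF : R -> R) (a : R) :
  (forall t, a < t -> is_derive t 1 v (dv t)) ->
  (forall t, a < t -> is_derive t 1 F (dF t)) ->
  (forall t, a < t -> `|dv t| <= dF t) ->
  forall s t, a < s -> s <= t -> `|v t - v s| <= F t - F s.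
Proof.
move=> vd Fd dvF s t as_ st; set u := v t - v s.
(* The main argument ends by dividing by |u|. When [u] is 0, it remains that [F] is nondecreasing,
   which holds since [dF] dominates a norm. *)
have [->|u0] := eqVneq u 0.
  rewrite normr0 subr_ge0 -lerN2.
  apply: (@is_derive_le0_nincry _ (- F) (- dF) a) => // r ar.
    exact: is_deriveN (Fd r ar).
  by rewrite oppr_le0; exact: le_trans (dvF _ ar).
have nu : 0 < `|u| by rewrite normr_gt0.
have D r : a < r -> is_derive r 1 (fun r => dot (v r) u - F r * `|u|)
    (dot (dv r) u - dF r * `|u|).
  move=> ar; apply: is_deriveB.
    apply: is_derive_eq (is_derive_dot normE (vd _ ar) (is_derive_cst u r 1)) _.
    by rewrite -(scale0r (0 : H)) dotZr mul0r addr0.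
  apply: is_derive_eq (is_deriveM (Fd r ar) (is_derive_cst `|u| r 1)) _.
  by rewrite scaler0 add0r /= [RHS]mulrC.
have := is_derive_le0_nincry D _ as_ st.
move=> /(_ _)/wrap[r ar|].
  rewrite subr_le0; apply: le_trans (dot_le normE _ _) _.
  by rewrite ler_pM2r//; exact: dvF.
rewrite lerBlDr -lerBlDr => A.
have : dot u u <= (F t - F s) * `|u|.
  rewrite {1}/u dotBl; lra.
by rewrite (dotuu normE) expr2 ler_pM2r.
Qed.

(** An integrable derivative forces convergence, here without vector-valued integrals: [F] is
    nondecreasing and bounded, so past a time where it is within e of its supremum, [v] moves by
    less than e. Completeness concludes. *)
Lemma cvg_of_dist_le_primitive (v dv : R -> H) (F dF : R -> R) (a C : R) :
  (forall t, a < t -> is_derive t 1 v (dv t)) ->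
  (forall t, a < t -> is_derive t 1 F (dF t)) ->
  (forall t, a < t -> `|dv t| <= dF t) ->
  (forall t, a < t -> F t <= C) ->
  cvg (v t @[t --> +oo]).
Proof.
move=> vd Fd dvF FC; have vF := dist_le_primitive vd Fd dvF.
apply/cauchy_cvgP/cauchy_exP => e e0.
pose A := [set F t | t in [set t | a < t]].
have supA : has_sup A.
  split; first by exists (F (a + 1)), (a + 1) => //=; rewrite ltrDl.
  by exists C => _ [t at_ <-]; exact: FC.
have [_ [p ap <-] Fp] := sup_adherent e0 supA.
exists (v p); suff : \forall t \near +oo, ball (v p) e (v t) by [].
near=> t; rewrite -ball_normE/= distrC.
have pt : p <= t by near: t; apply: nbhs_pinfty_ge; rewrite num_real.
apply: le_lt_trans (vF _ _ ap pt) _.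
have : F t <= sup A.
  by apply: ub_le_sup; [case: supA|exists t => //=; exact: lt_le_trans pt].
lra.
Unshelve. all: end_near.
Qed.

End Curves.

(** * Interior derivatives and continuity of locally Lipschitz maps *)

Lemma is_derive_within_interior (R : realType) (V : normedModType R) (D : set R)
    (f : R -> V) (t : R) (l : V) :
  D° t -> is_derive_within D f t l -> is_derive t 1 f l.
Proof.
move=> Dt fl; apply/is_derive1_cvgP/cvgrPdist_le => e e0.
have /cvgrPdist_le/(_ e e0) := fl; rewrite !near_withinE => fle.
have {}fle : \forall s \near t,
    s != t -> `|l - (s - t)^-1 *: (f s - f t)| <= e.
  by apply: filterS2 Dt fle => s Ds + st; apply.
move: fle; rewrite (near_shift 0) subr0; apply: filterS => h /= + h0.
by rewrite addrK; apply; rewrite -subr_eq0 addrK.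
Qed.

Lemma lipschitz_on_bounded_sets_continuous (R : realType)
    (V W : normedModType R) (f : V -> W) :
  lipschitz_on_bounded_sets f -> continuous f.
Proof.
move=> flip u.
have bB : bounded_set (ball u 1).
  exists (`|u| + 1); split; first exact: num_real.
  move=> M uM v; rewrite -ball_normE/= => uv; apply: le_trans (ltW uM).
  have -> : v = u - (u - v) by rewrite opprB addrC subrK.
  by apply: le_trans (ler_normB _ _) _; rewrite lerD2l ltW.
(* Every constant above [M] is a Lipschitz constant on the unit ball at [u]; this one is also
   positive, so it can be divided by. *)
have [M [_ /(_ (`|M| + 1))]] := flip _ bB.
have M1 : 0 < `|M| + 1 by rewrite ltr_wpDl.
rewrite (le_lt_trans (ler_norm M)) ?ltrDl// => /(_ isT) fM.
apply/cvgrPdist_le => e e0; near=> v.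
have uv : `|u - v| <= e / (`|M| + 1).
  by near: v; apply: cvgr_dist_le; [exact: cvg_id|rewrite divr_gt0].
have Bv : ball u 1 v by near: v; exact: nbhsx_ballx.
have := fM (u, v) (conj (ballxx u ltr01) Bv) => /= /le_trans; apply.
by rewrite mulrC -ler_pdivlMr.
Unshelve. all: end_near. Qed.

(** * Asymptotics of the Euler equation *)

Section EulerODE.
Context (R : realType) (H : completeNormedModType R).
Context (dot : {dot H for (@idfun R)}) (normE : norm_from_dot dot).

(* With [p = y - c^-1 l] and [e = c p + t p' -> 0], the derivative of
   [t (|p|^2 - d^2)] is at most [|e|^2 - d^2], which is eventually negative. *)
Lemma cvg_of_euler_operator (y dy : R -> H) (a c : R) (l : H) :
  1 <= c -> (forall t, a < t -> is_derive t 1 y (dy t)) ->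
  c *: y t + t *: dy t @[t --> +oo] --> l ->
  y t @[t --> +oo] --> c^-1 *: l.
Proof.
move=> c1 yd yl; apply/cvgrPdist_le => e0 e00.
have c0 : c != 0 by rewrite gt_eqF// (lt_le_trans _ c1).
pose d := e0 / 2; have d0 : 0 < d by rewrite divr_gt0.
pose p t := y t - c^-1 *: l.
pose e t := c *: p t + t *: dy t.
have eE t : e t = c *: y t + t *: dy t - l.
  by rewrite /e /p scalerBr scalerA divff// scale1r addrAC.
have /cvgrPdist_le/(_ d d0)[T [_ eT]] := yl.
pose T1 := `|a| + `|T| + 1.
have T1a : a < T1.
  by rewrite /T1; have := ler_norm a; have := normr_ge0 T; lra.
have TT1 : T < T1.
  by rewrite /T1; have := ler_norm T; have := normr_ge0 a; lra.
have T10 : 0 < T1.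
  by rewrite /T1; have := normr_ge0 T; have := normr_ge0 a; lra.
have ed t : T1 < t -> `|e t| <= d.
  by move=> tT; rewrite eE distrC; apply: eT; exact: lt_trans tT.
have pd t : T1 < t -> is_derive t 1 p (dy t).
  move=> tT; apply: is_derive_eq (subr0 _).
  by apply: is_deriveB; apply: yd; exact: lt_trans tT.
pose f t := t * (dot (p t) (p t) - d ^+ 2).
(* The term t p' is replaced by e - c p. *)
have fd t : T1 < t ->
    is_derive t 1 f (dot (p t) (p t) - d ^+ 2 + 2 * (dot (p t) (e t) - c * dot (p t) (p t))).
  move=> tT.
  have qd := is_derive_dot normE (pd t tT) (pd t tT).
  have rd : is_derive t 1 (fun s => dot (p s) (p s) - d ^+ 2)
      (dot (dy t) (p t) + dot (p t) (dy t) - 0).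
    exact: is_deriveB qd (is_derive_cst (d ^+ 2) t 1).
  apply: is_derive_eq (is_derive1_mul (is_derive_id t 1) rd) _.
  by rewrite /e (dotDr dot (c *: p t)) !dotZr (dotC dot (dy t)); ring.
(* Here 2 <p, e> <= |p|^2 + |e|^2, and the remaining multiple 2 (1 - c) of |p|^2 is nonpositive. *)
have fd0 t : T1 < t ->
    dot (p t) (p t) - d ^+ 2 + 2 * (dot (p t) (e t) - c * dot (p t) (p t)) <= 0.
  move=> tT; have := dot_le normE (p t) (e t); rewrite (dotuu normE) => pe.
  have := ed t tT; have := normr_ge0 (p t); have := normr_ge0 (e t).
  move: pe; set P := `|p t|; set E := `|e t| => pe P0 E0 Ed.
  have : E ^+ 2 <= d ^+ 2 by rewrite ler_sqr ?nnegrE// ltW.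
  have : 0 <= (P - E) ^+ 2 by exact: sqr_ge0.
  have : 0 <= (c - 1) * P ^+ 2 by rewrite mulr_ge0 ?sqr_ge0// subr_ge0.
  nra.
have fle := is_derive_le0_nincry fd fd0.
near=> t.
have tT : T1 + 1 <= t by near: t; apply: nbhs_pinfty_ge; rewrite num_real.
(* For such [t] the initial value of [f] is absorbed by t d^2, which leaves |p|^2 <= 2 d^2 <=
   e0^2. *)
have tf : f (T1 + 1) / d ^+ 2 <= t.
  by near: t; apply: nbhs_pinfty_ge; rewrite num_real.
rewrite distrC -/(p t).
have := fle _ _ _ tT; rewrite ltrDl ltr01 => /(_ isT) ft.
have t0 : 0 < t by lra.
have d20 : 0 < d ^+ 2 by rewrite exprn_gt0.
have {}tf : f (T1 + 1) <= t * d ^+ 2 by rewrite -ler_pdivrMr.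
have : t * dot (p t) (p t) <= t * (2 * d ^+ 2).
  by move: ft; rewrite {1}/f; lra.
rewrite ler_pM2l// (dotuu normE) => pt.
rewrite -ler_sqr ?nnegrE ?(ltW e00)//; apply: le_trans pt _.
have -> : e0 = 2 * d by rewrite /d mulrC divfK.
by move: d20; rewrite !expr2; lra.
Unshelve. all: end_near.
Qed.

End EulerODE.

(** * Regularity along the solution *)

Lemma is_derive_gradient (R : realType) (H : completeNormedModType R)
    (dot : {dot H for (@idfun R)}) (Phi : H -> R) (G : H -> H) (x : R -> H)
    (t : R) (dx : H) :
  (forall u, differentiable Phi u) -> is_gradient dot Phi G ->
  is_derive t 1 x dx -> is_derive t 1 (fun s => Phi (x s)) (dot (G (x t)) dx).
Proof.
move=> Phi_diff GE [xder xD].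
have xdiff : differentiable x t by apply/derivable1_diffP.
have cdiff : differentiable (Phi \o x) t by exact: differentiable_comp.
split; first exact: diff_derivable.
by rewrite (deriveE _ cdiff) diff_comp//= -(deriveE _ xdiff) xD GE.
Qed.

(** The equation writes [g] as a sum of functions continuous beyond [t0]. This continuity makes t
    |g| the derivative of its integral. *)
Lemma solution_forcing_continuous (R : realType) (H : completeNormedModType R)
    (t0 alpha : R) (G : H -> H) (g x dx ddx : R -> H) :
  0 < t0 -> continuous G ->
  (forall t, t0 < t -> is_derive t 1 x (dx t)) ->
  (forall t, t0 < t -> is_derive t 1 dx (ddx t)) ->
  {within `[t0, +oo[, continuous ddx} ->
  (forall t, t0 <= t -> ddx t + (alpha / t) *: dx t + G (x t) = g t) ->
  forall t, t0 < t -> {for t, continuous g}.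
Proof.
move=> t00 Gc xd dxd ddxc ode t tt0.
have near_t0 : \forall s \near t, t0 <= s.
  by apply: filterS (lt_nbhsr tt0) => s; exact: ltW.
have ddxc' : {for t, continuous ddx}.
  have : {within `]t0, +oo[, continuous ddx}.
    by apply: continuous_subspaceW ddxc; apply: subset_itvr; rewrite bnd_simp.
  rewrite continuous_open_subspace; last exact: rray_open.
  by apply; rewrite inE/= in_itv/= andbT.
have xc := is_derive_continuous (xd t tt0).
have : ddx s + (alpha / s) *: dx s + G (x s) @[s --> t] --> g t.
  rewrite -(ode t (ltW tt0)); apply: cvgD; last exact: (cvg_comp _ _ xc (Gc _)).
  apply: cvgD; first exact: ddxc'.
  apply: cvgZ; last exact: is_derive_continuous (dxd t tt0).
  apply: cvgM; first exact: cvg_cst.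
  by apply: cvgV; [rewrite gt_eqF// (lt_trans t00)|exact: cvg_id].
by apply: cvg_trans; apply: near_eq_cvg; apply: filterS near_t0 => s /ode.
Qed.

(** * Energy estimate and strong convergence of the trajectory *)

Theorem theorem3p2 (R : realType) (H : completeNormedModType R)
    (dot : {dot H for (@idfun R)}) (normE : norm_from_dot dot)
    (Phi : H -> R) (gradPhi : H -> H)
    (Phi_convex : convex_function [set: convex_lmodType H] Phi)
    (Phi_diff : forall u : H, differentiable Phi u)
    (gradPhiE : is_gradient dot Phi gradPhi)
    (gradPhi_lip : lipschitz_on_bounded_sets gradPhi)
    (argmin_int : interior (argmin Phi) !=set0)
    (t0 alpha : R) (t0_gt0 : 0 < t0) (alpha_gt3 : 3 < alpha)
    (g : R -> H)
    (g_int : (\int[lebesgue_measure]_(t in `[t0, +oo[)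
                (t * `|g t|)%:E < +oo)%E)
    (x : R -> H)
    (x_sol : classical_global_solution t0 alpha gradPhi g x) :
  exists xstar : H, argmin Phi xstar /\ x t @[t --> +oo] --> xstar.
Proof.
have [dx [ddx [xd' dxd' ddxc ode]]] := x_sol.
have int_t0 t : t0 < t -> `[t0, +oo[%classic° t.
  by move=> tt0; rewrite interior_itv_bndy/= in_itv/= tt0.
have xd t : t0 < t -> is_derive t 1 x (dx t).
  by move=> tt0; apply: is_derive_within_interior (int_t0 _ tt0) (xd' _ (ltW tt0)).
have dxd t : t0 < t -> is_derive t 1 dx (ddx t).
  by move=> tt0; apply: is_derive_within_interior (int_t0 _ tt0) (dxd' _ (ltW tt0)).
have gc := solution_forcing_continuous t0_gt0
  (lipschitz_on_bounded_sets_continuous gradPhi_lip) xd dxd ddxc ode.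
have [z /nbhs_ballP[e /= e0 zint]] := argmin_int.
(* Halving the radius puts a closed ball inside the open one, as [gradient_interior] requires. *)
pose rho := e / 2; have rho0 : 0 < rho by rewrite divr_gt0.
have zmin : argmin Phi z by apply: zint; exact: ballxx.
have gradint := gradient_interior normE Phi_convex Phi_diff gradPhiE rho0 _.
have {}gradint u : rho * `|gradPhi u| <= dot (gradPhi u) (u - z).
  apply: gradint => p pz; apply: zint; rewrite -ball_normE/= distrC.
  by apply: le_lt_trans pz _; rewrite /rho ltr_pdivrMr// ltr_pMr// ltr1n.
pose w t := t * `|g t|.
have wc t : t0 < t -> {for t, continuous w}.
  by move=> tt0; apply: cvgM; [exact: cvg_id|apply: cvg_norm; exact: gc].
have w0 t : t0 <= t -> 0 <= w t.
  by move=> tt0; rewrite mulr_ge0// (le_trans (ltW t0_gt0)).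
pose a := t0 + 1; have t0a : t0 < a by rewrite ltrDl.
have [W [C [Wd WC]]] := bounded_primitive t0a wc w0 g_int.
have at0 t : a < t -> t0 < t by exact: lt_trans.
pose c := alpha - 1.
pose v t := c *: (x t - z) + t *: dx t.
pose dv t := t *: (g t - gradPhi (x t)).
have vd t : a < t -> is_derive t 1 v (dv t).
  move=> /at0 tt0.
  have xzd : is_derive t 1 (fun s => x s - z) (dx t - 0).
    exact: is_deriveB (xd t tt0) (is_derive_cst z t 1).
  have cxd := is_deriveZ c xzd.
  have tdx := is_derive1_scale (is_derive_id t 1) (dxd t tt0).
  apply: is_derive_eq (is_deriveD cxd tdx) _.
  (* The terms in [dx] add up to c + 1 = alpha, exactly the damping term of the equation multiplied
     by t. *)
  have t_neq0 : t != 0 by rewrite gt_eqF// (lt_trans t0_gt0).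
  rewrite subr0 scale1r /dv -(ode t (ltW tt0)) addrK scalerDr scalerA mulrCA.
  rewrite divff// mulr1 addrA -[in c *: _ + _](scale1r (dx t)).
  by rewrite scalerA -scalerDl mulr1 /c subrK addrC.
pose E t := t ^+ 2 * (Phi (x t) - Phi z) + dot (v t) (v t) / 2.
pose dE t := 2 * t * (Phi (x t) - Phi z)
  - c * t * dot (gradPhi (x t)) (x t - z) + t * dot (v t) (g t).
have Ed t : a < t -> is_derive t 1 E (dE t).
  move=> ta; have tt0 := at0 t ta.
  have Pd : is_derive t 1 (fun s => Phi (x s) - Phi z)
      (dot (gradPhi (x t)) (dx t) - 0).
    exact: is_deriveB (is_derive_gradient Phi_diff gradPhiE (xd t tt0))
      (is_derive_cst (Phi z) t 1).
  have t2d := is_derive1_mul (is_derive_id t 1) (is_derive_id t 1).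
  have vvd : is_derive t 1 (fun s => dot (v s) (v s) / 2)
      ((dot (dv t) (v t) + dot (v t) (dv t)) / 2 + dot (v t) (v t) * 0).
    exact: is_derive1_mul (is_derive_dot normE (vd t ta) (vd t ta))
      (is_derive_cst (2^-1 : R) t 1).
  apply: is_derive_eq (is_deriveD (is_derive1_mul t2d Pd) vvd) _.
  rewrite (dotC dot (v t) (dv t)).
  (* The last term, multiplied by t, cancels t^2 times the derivative of [Phi] along the
     trajectory. *)
  have -> : dot (dv t) (v t) = t * (dot (v t) (g t)
      - c * dot (gradPhi (x t)) (x t - z) - t * dot (gradPhi (x t)) (dx t)).
    rewrite /dv dotZl dotBl (dotC dot (g t)) /v (dotDr dot (c *: _)) !dotZr.
    by rewrite opprD addrA.
  by rewrite /dE; field.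
have Phi0 t : 0 <= Phi (x t) - Phi z by rewrite subr_ge0.
have Ege0 t : 0 <= E t.
  rewrite /E (dotuu normE); apply: addr_ge0; first exact: mulr_ge0 (sqr_ge0 t) _.
  by rewrite divr_ge0// sqr_ge0.
have E1 t : 0 <= 1 + E t := addr_ge0 ler01 (Ege0 t).
(* From (|v| - 1)^2 >= 0. Replacing |v| by 1 + E makes the differential inequality linear in 1 + E,
   ready for Gronwall. *)
have v_le t : `|v t| <= 1 + E t.
  rewrite /E (dotuu normE); have := mulr_ge0 (sqr_ge0 t) (Phi0 t).
  by have := sqr_ge0 (`|v t| - 1); nra.
(* Convexity gives Phi (x t) - Phi z <= <grad Phi (x t), x t - z>, so the first two terms of [dE]
   combine with coefficient -(c - 2). It is negative because alpha > 3, and [gradint] then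
   applies. *)
have dE_le t : a < t ->
    dE t <= w t * `|v t| - (c - 2) * rho * (t * `|gradPhi (x t)|).
  move=> ta; have t_gt0 : 0 < t := lt_trans t0_gt0 (at0 t ta).
  have := gradient_inequality Phi_convex Phi_diff gradPhiE (x t) z.
  have -> : z - x t = 0 - (x t - z) by rewrite sub0r opprB.
  have dot0 u : dot u 0 = 0 by exact: linear0r.
  rewrite (dotBr dot 0) dot0.
  have := gradint (x t); have := dot_le normE (v t) (g t).
  rewrite /dE /w; set D := dot _ (x t - z); set A := dot _ _.
  move=> Ale GD PD.
  have : t * A <= t * (`|v t| * `|g t|) by rewrite ler_pM2l.
  have : (c - 2) * (t * (rho * `|gradPhi (x t)|)) <= (c - 2) * (t * D).
    by rewrite ler_wpM2l ?ler_pM2l// /c; lra.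
  have : 2 * (t * (Phi (x t) - Phi z)) <= 2 * (t * D).
    by rewrite ler_pM2l// ler_pM2l//; lra.
  lra.
(* Since 0 <= W <= C, [expR C] dominates the Gronwall factor exp (W t - W (a + 1)). *)
pose K := (1 + E (a + 1)) * expR C.
have Ebound t : a + 1 <= t -> 1 + E t <= K.
  move=> ta.
  (* Gronwall, with integrating factor exp (- W) *)
  pose P s := (1 + E s) * expR (- W s).
  pose dP s := dE s * expR (- W s) + (1 + E s) * (expR (- W s) * - w s).
  have Pd s : a < s -> is_derive s 1 P (dP s).
    move=> sa; apply: is_derive1_mul.
      apply: is_derive_eq (add0r _).
      exact: is_deriveD (is_derive_cst (1 : R) s 1) (Ed s sa).
    exact: is_derive1_comp (is_derive_expR _) (is_deriveN (Wd s sa)).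
  have dP0 s : a < s -> dP s <= 0.
    move=> sa; have -> : dP s = expR (- W s) * (dE s - w s * (1 + E s)).
      by rewrite /dP; ring.
    rewrite pmulr_rle0 ?expR_gt0// subr_le0.
    have s_ge0 : 0 <= s by rewrite ltW// (lt_trans t0_gt0)// at0.
    apply: le_trans (dE_le s sa) _; rewrite lerBlDr ler_wpDr//.
      rewrite !mulr_ge0 ?(ltW rho0)// /c; lra.
    by rewrite ler_wpM2l// w0// ltW// at0.
  have := is_derive_le0_nincry Pd dP0 _ ta; rewrite ltrDl ltr01 => /(_ isT).
  rewrite /P expRN ler_pdivrMr ?expR_gt0// => /le_trans; apply.
  rewrite -mulrA ler_wpM2l ?E1// -expRD ler_expR.
  by have := WC t; have := WC (a + 1); lra.
have K0 : 0 <= K by rewrite mulr_ge0 ?E1// expR_ge0.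
have vK t : a + 1 <= t -> `|v t| <= K.
  by move=> ta; exact: le_trans (v_le t) (Ebound t ta).
(* With |v| <= K, solving [dE_le] for the gradient term gives t |grad Phi (x t)| <= k (K w - dE).
   The right-hand side has the explicit primitive k (K W - E), bounded above because E >= 0 and W <=
   C; adding [W] accounts for [g]. *)
pose k := ((c - 2) * rho)^-1.
have k0 : 0 < k by rewrite invr_gt0 mulr_gt0// /c; lra.
pose F t := W t + k * (K * W t - E t).
pose dF t := w t + k * (K * w t - dE t).
have Fd t : a + 1 < t -> is_derive t 1 F (dF t).
  move=> ta; have {}ta : a < t by rewrite (lt_trans _ ta)// ltrDl.
  have KWE : is_derive t 1 (fun s => K * W s - E s) (K * w t - dE t).
    exact: is_deriveB (is_deriveZ K (Wd t ta)) (Ed t ta).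
  exact: is_deriveD (Wd t ta) (is_deriveZ k KWE).
have dvF t : a + 1 < t -> `|dv t| <= dF t.
  move=> ta1; have ta : a < t by rewrite (lt_trans _ ta1)// ltrDl.
  have t_gt0 : 0 < t := lt_trans t0_gt0 (at0 t ta).
  rewrite /dv normrZ (gtr0_norm t_gt0).
  apply: (@le_trans _ _ (w t + t * `|gradPhi (x t)|)).
    by rewrite /w -mulrDr ler_pM2l// ler_normB.
  rewrite lerD2l -[leLHS](mulVKf (lt0r_neq0 k0)) ler_pM2l// /k invrK.
  have := dE_le t ta.
  have : w t * `|v t| <= w t * K.
    by rewrite ler_wpM2l ?(vK _ (ltW ta1))// w0// ltW// at0.
  lra.
have FC t : a + 1 < t -> F t <= C + k * (K * C).
  move=> _; have /andP[_ WCt] := WC t; rewrite lerD// ler_pM2l// lerBlDr.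
  by rewrite ler_wpDr// ler_wpM2l.
have vd1 t : a + 1 < t -> is_derive t 1 v (dv t).
  by move=> ta; apply: vd; rewrite (lt_trans _ ta)// ltrDl.
have /cvg_ex[l vl] := cvg_of_dist_le_primitive normE vd1 Fd dvF FC.
have xl : x t @[t --> +oo] --> z + c^-1 *: l.
  have c1 : 1 <= c by rewrite /c; lra.
  have xzd t : t0 < t -> is_derive t 1 (fun s => x s - z) (dx t).
    move=> tt0; apply: is_derive_eq (subr0 _).
    exact: is_deriveB (xd t tt0) (is_derive_cst z t 1).
  have := cvg_of_euler_operator normE c1 xzd vl.
  move=> /(cvgD (cvg_cst z)); apply: cvg_trans; apply: near_eq_cvg.
  by apply: nearW => t; rewrite /= addrC subrK.
exists (z + c^-1 *: l); split => //.
(* As t >= 1, the factor t^2 in the energy may be weakened to t; the rate K / t suffices for the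
   limit. *)
have PhiK t : a + 1 <= t -> Phi (x t) - Phi z <= K / t.
  move=> ta; have t1 : 1 <= t by rewrite /a in ta; lra.
  rewrite ler_pdivlMr; last by rewrite (lt_le_trans _ t1).
  apply: le_trans (Ebound t ta); rewrite /E (dotuu normE) mulrC.
  have : t * (Phi (x t) - Phi z) <= t ^+ 2 * (Phi (x t) - Phi z).
    by rewrite ler_wpM2r// expr2 ler_peMl// (le_trans _ t1).
  have := sqr_ge0 `|v t|; lra.
have Phil : Phi (x t) - Phi z @[t --> +oo] --> Phi (z + c^-1 *: l) - Phi z.
  apply: cvgB; last exact: cvg_cst.
  exact: (cvg_comp _ _ xl (differentiable_continuous (Phi_diff _))).
have Phil0 : Phi (x t) - Phi z @[t --> +oo] --> 0.
  apply: (@squeeze_cvgr _ _ _ _ (fun=> 0) (fun t => K / t)).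
  - apply: filterS (nbhs_pinfty_ge (num_real (a + 1))) => t ta.
    by rewrite Phi0 PhiK.
  - exact: cvg_cst.
  - rewrite -[X in _ --> X](mulr0 K); apply: cvgM; first exact: cvg_cst.
    apply/gtr0_cvgV0; last exact: cvg_id.
    by apply: nbhs_pinfty_gt; rewrite num_real.
have PhilE : Phi (z + c^-1 *: l) - Phi z = 0.
  have := cvg_lim (@Rhausdorff R) Phil.
  by rewrite (cvg_lim (@Rhausdorff R) Phil0) => <-.
by move=> u; rewrite (subr0_eq PhilE); exact: zmin.
Qed.
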